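(* Consider a linear pentapod of Type 1 or Type 2 with fixed geometric parameters $A\neq0$, $C$, $a_r$, $a_c\neq0$, $a_4$, and any leg parameters satisfying (SM1)–(SM2). For real $t$, let $\mathfrak p_t$ denote the point of $\mathfrak p$ with parameter $t$, and let $\mathbf P_t=\Big(\frac{A(a_r^2+a_c^2-ta_r)}{(t-a_r)^2+a_c^2},\,-\frac{Aa_ct}{(t-a_r)^2+a_c^2},\,\frac{Ca_4}{a_4-t}\Big)^T$. Let $\mathfrak C$ be the point $\mathbf P_c$ with $c=\frac{a_4^2-a_c^2-a_r^2}{2(a_4-a_r)}$ if $a_4\neq a_r$, and $\mathfrak C=\mathfrak M_5=(0,0,0)$ if $a_4=a_r$. Then for every $t\in\mathbb R\setminus\{a_4\}$, in every real pose of the self-motion the image of $\mathfrak p_t$ lies on the ellipsoid of rotation with center $\mathfrak C$, axis of rotation parallel to the $z$-axis of the fixed frame, semi-axis $|a_4-t|$ along this axis and equator radius $\sqrt{(a_r-t)^2+a_c^2}$; moreover $\mathfrak p_t$ runs on a sphere centered at $\mathbf P_t$ (a plane if $\mathbf P_t$ is ideal). For $t=a_4$, the image of $\mathfrak p_{a_4}$ lies in the plane $z=p_4$ on a circular disc centered at $\mathfrak C$. For $a_4\neq a_r$ the only one of these ellipsoids that is a sphere is the one for $t=c$; for $a_4=a_r$ none is a sphere.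
   Context: Euclidean displacements $\mathbf x\mapsto \mathbf R\mathbf x+\mathbf s$ (rows $\mathbf r_j$ of $\mathbf R$). Fixed frame: $\mathfrak M_5=(0,0,0)$, $\mathfrak M_1=(A,0,C)$, $A\ne0$; $\mathfrak M_2,\mathfrak M_3,\mathfrak M_4$ ideal points in directions $(1,i,0)^T,(1,-i,0)^T,(0,0,1)^T$. Platform line $\mathfrak p$: point with parameter $t$ is $\mathbf n+(t-a_r)\mathbf d$ ($\mathbf d$ unit vector); $\mathfrak m_j$ has parameter $a_j$ with $a_1=0$, $a_2=a_r+ia_c$, $a_3=a_r-ia_c$, $a_4\in\mathbb R$, $a_r,a_c\in\mathbb R$, $a_c\ne0$. Leg constraints: $\|\mathbf R\mathbf m_1+\mathbf s-\mathbf M_1\|^2=R_1^2$; $(s_1+\mathbf r_1\mathbf m_2)-i(s_2+\mathbf r_2\mathbf m_2)=p_2$; $(s_1+\mathbf r_1\mathbf m_3)+i(s_2+\mathbf r_2\mathbf m_3)=p_3$; $s_3+\mathbf r_3\mathbf m_4=p_4$; $(\mathbf R\mathbf d)\cdot(\mathbf s+\mathbf R(\mathbf n+(p_5-a_r)\mathbf d))=0$. With $v=a_2+a_3-2a_4$, $w=a_2a_3-a_4^2$, the self-motion conditions are (SM1) $p_2=\frac{Aa_3v}{(a_3-a_4)^2}$, $p_3=\frac{Aa_2v}{(a_2-a_4)^2}$, $p_4=-\frac{Ca_4v}{(a_2-a_4)(a_3-a_4)}$ and (SM2) $(a_2-a_4)^2(a_3-a_4)^2[2wp_5-vR_1^2-(2w-va_4)a_4]+vw^2(A^2+C^2)=0$;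 the self-motion is the one-parameter set of poses of $\mathfrak p$ satisfying all five constraints. Type 1: $a_4\ne0\ne C$; Type 2: $a_4=0=C$. *)

(* Defs.v *)
From Stdlib Require Import Reals Lra.
Open Scope R_scope.

Record V3 := mkV3 { vx : R ; vy : R ; vz : R }.

Definition dot (u v : V3) : R := vx u * vx v + vy u * vy v + vz u * vz v.
Definition vadd (u v : V3) : V3 := mkV3 (vx u + vx v) (vy u + vy v) (vz u + vz v).
Definition vsub (u v : V3) : V3 := mkV3 (vx u - vx v) (vy u - vy v) (vz u - vz v).
Definition vscale (k : R) (u : V3) : V3 := mkV3 (k * vx u) (k * vy u) (k * vz u).
Definition cross (u v : V3) : V3 :=
  mkV3 (vy u * vz v - vz u * vy v) (vz u * vx v - vx u * vz v) (vx u * vy v - vy u * vx v).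
Definition origin : V3 := mkV3 0 0 0.

Record Cx := mkC { re : R ; im : R }.
Definition RC (x : R) : Cx := mkC x 0.
Definition Ci : Cx := mkC 0 1.
Definition Cadd (z w : Cx) : Cx := mkC (re z + re w) (im z + im w).
Definition Csub (z w : Cx) : Cx := mkC (re z - re w) (im z - im w).
Definition Cmul (z w : Cx) : Cx :=
  mkC (re z * re w - im z * im w) (re z * im w + im z * re w).
Definition Cinv (z : Cx) : Cx :=
  mkC (re z / (re z ^ 2 + im z ^ 2)) (- im z / (re z ^ 2 + im z ^ 2)).
Definition Cdiv (z w : Cx) : Cx := Cmul z (Cinv w).

Record CV3 := mkCV3 { cvre : V3 ; cvim : V3 }.
Definition dotRC (r : V3) (m : CV3) : Cx := mkC (dot r (cvre m)) (dot r (cvim m)).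

Record Pose := mkPose { r1 : V3 ; r2 : V3 ; r3 : V3 ; sv : V3 }.

Definition is_rotation (P : Pose) : Prop :=
  dot (r1 P) (r1 P) = 1 /\ dot (r2 P) (r2 P) = 1 /\ dot (r3 P) (r3 P) = 1 /\
  dot (r1 P) (r2 P) = 0 /\ dot (r1 P) (r3 P) = 0 /\ dot (r2 P) (r3 P) = 0 /\
  dot (r1 P) (cross (r2 P) (r3 P)) = 1.

Definition rotate (P : Pose) (x : V3) : V3 :=
  mkV3 (dot (r1 P) x) (dot (r2 P) x) (dot (r3 P) x).
Definition image (P : Pose) (x : V3) : V3 := vadd (rotate P x) (sv P).

Definition platform_pt (n d : V3) (ar t : R) : V3 := vadd n (vscale (t - ar) d).
Definition platform_ptC (n d : V3) (ar : R) (tau : Cx) : CV3 :=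
  mkCV3 (vadd n (vscale (re tau - ar) d)) (vscale (im tau) d).

Definition a2C (ar ac : R) : Cx := mkC ar ac.
Definition a3C (ar ac : R) : Cx := mkC ar (- ac).

(* ---------- the five leg constraints; fixed frame M5 = 0, M1 = (A,0,C) ---------- *)
Definition self_motion (A C ar ac a4 : R) (n d : V3) (R1 : R) (p2 p3 : Cx) (p4 p5 : R)
  (P : Pose) : Prop :=
  let m1 := platform_pt n d ar 0 in
  let m2 := platform_ptC n d ar (a2C ar ac) in
  let m3 := platform_ptC n d ar (a3C ar ac) in
  let m4 := platform_pt n d ar a4 in
  let s := sv P in
  is_rotation P /\
  (let u := vsub (image P m1) (mkV3 A 0 C) in dot u u = R1 ^ 2) /\
  Csub (Cadd (RC (vx s)) (dotRC (r1 P) m2))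
       (Cmul Ci (Cadd (RC (vy s)) (dotRC (r2 P) m2))) = p2 /\
  Cadd (Cadd (RC (vx s)) (dotRC (r1 P) m3))
       (Cmul Ci (Cadd (RC (vy s)) (dotRC (r2 P) m3))) = p3 /\
  vz s + dot (r3 P) m4 = p4 /\
  dot (rotate P d) (vadd s (rotate P (platform_pt n d ar p5))) = 0.

Definition vC (ar ac a4 : R) : Cx :=
  Csub (Cadd (a2C ar ac) (a3C ar ac)) (RC (2 * a4)).
Definition wC (ar ac a4 : R) : Cx :=
  Csub (Cmul (a2C ar ac) (a3C ar ac)) (RC (a4 ^ 2)).
Definition Csq (z : Cx) : Cx := Cmul z z.

Definition SM1 (A C ar ac a4 : R) (p2 p3 : Cx) (p4 : R) : Prop :=
  let a2 := a2C ar ac in let a3 := a3C ar ac in let v := vC ar ac a4 in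
  p2 = Cdiv (Cmul (Cmul (RC A) a3) v) (Csq (Csub a3 (RC a4))) /\
  p3 = Cdiv (Cmul (Cmul (RC A) a2) v) (Csq (Csub a2 (RC a4))) /\
  RC p4 = Cdiv (Cmul (Cmul (RC (- C)) (RC a4)) v)
               (Cmul (Csub a2 (RC a4)) (Csub a3 (RC a4))).

Definition SM2 (A C ar ac a4 R1 p5 : R) : Prop :=
  let a2 := a2C ar ac in let a3 := a3C ar ac in
  let v := vC ar ac a4 in let w := wC ar ac a4 in
  Cadd
    (Cmul (Cmul (Csq (Csub a2 (RC a4))) (Csq (Csub a3 (RC a4))))
          (Csub (Csub (Cmul (RC 2) (Cmul w (RC p5))) (Cmul v (RC (R1 ^ 2))))
                (Cmul (Csub (Cmul (RC 2) w) (Cmul v (RC a4))) (RC a4))))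
    (Cmul (Cmul v (Csq w)) (RC (A ^ 2 + C ^ 2)))
  = RC 0.

Definition Ppt (A C ar ac a4 t : R) : V3 :=
  mkV3 (A * (ar ^ 2 + ac ^ 2 - t * ar) / ((t - ar) ^ 2 + ac ^ 2))
       (- (A * ac * t) / ((t - ar) ^ 2 + ac ^ 2))
       (C * a4 / (a4 - t)).

Definition cpar (ar ac a4 : R) : R := (a4 ^ 2 - ac ^ 2 - ar ^ 2) / (2 * (a4 - ar)).

Definition centre (A C ar ac a4 : R) : V3 :=
  if Req_EM_T a4 ar then origin else Ppt A C ar ac a4 (cpar ar ac a4).

Definition on_ellipsoid_rot (c : V3) (h r : R) (X : V3) : Prop :=
  ((vx X - vx c) ^ 2 + (vy X - vy c) ^ 2) / r ^ 2 + (vz X - vz c) ^ 2 / h ^ 2 = 1.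

Definition ellipsoid_is_sphere (h r : R) : Prop := h = r.

Definition dist2 (X Y : V3) : R := let u := vsub X Y in dot u u.

(* Main.v *)
(* Write [D] for the rotated direction of the platform line and [X_s] for the image of
   its point with parameter [s].  Legs 2 and 4 fix the image of the foot point up to a
   displacement that is linear in [D], and (SM1) says that the fixed part is the centre
   [Cc].  Hence [X_s - Cc = offset s D], where [offset s] multiplies the horizontal
   part of [D], read as a complex number, by [s - a3] and its vertical part by [s - a4];
   since [D] is a unit vector, [X_s] lies on the stated ellipsoid, and on the disc for [s = a4].
   Legs 1 and 5 read [|X_0 - M_1|^2 = R_1^2] and [D . X_(p5) = 0].  The point [P_t] is
   the solution of [offset t D . P_t = offset 0 D . M_1] for all [D], which makes
   [|X_t - P_t|^2 - |X_0 - M_1|^2 - 2 t D . X_(p5)] independent of [D]. *)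
Require Import Defs.
From Stdlib Require Import Reals Lra Psatz.
Open Scope R_scope.

(* Both sides equal [det(M)^2 |x|^2], where [M] has rows [a, b, c]: the left one is
   [|x|^2 det G] for the Gram matrix [G = M M^T], the right one [y^T adj(G) y] for
   [y = M x]. *)
Lemma gram_identity (a b c x : V3) :
  let gaa := dot a a in let gbb := dot b b in let gcc := dot c c in
  let gab := dot a b in let gac := dot a c in let gbc := dot b c in
  let ya := dot a x in let yb := dot b x in let yc := dot c x in
  dot x x * (gaa * gbb * gcc + 2 * gab * gac * gbc
             - gaa * gbc ^ 2 - gbb * gac ^ 2 - gcc * gab ^ 2)
  = (gbb * gcc - gbc ^ 2) * ya ^ 2 + (gaa * gcc - gac ^ 2) * yb ^ 2
    + (gaa * gbb - gab ^ 2) * yc ^ 2 + 2 * (gac * gbc - gab * gcc) * ya * yb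
    + 2 * (gab * gbc - gac * gbb) * ya * yc + 2 * (gab * gac - gaa * gbc) * yb * yc.
Proof.
  destruct a as [a1 a2 a3], b as [b1 b2 b3], c as [c1 c2 c3], x as [x1 x2 x3].
  unfold dot; simpl; ring.
Qed.

Lemma dot_rotate_orthonormal (P : Pose) (x : V3) :
  dot (r1 P) (r1 P) = 1 -> dot (r2 P) (r2 P) = 1 -> dot (r3 P) (r3 P) = 1 ->
  dot (r1 P) (r2 P) = 0 -> dot (r1 P) (r3 P) = 0 -> dot (r2 P) (r3 P) = 0 ->
  dot (rotate P x) (rotate P x) = dot x x.
Proof.
  intros H11 H22 H33 H12 H13 H23.
  pose proof gram_identity (r1 P) (r2 P) (r3 P) x as G; simpl in G.
  rewrite H11, H22, H33, H12, H13, H23 in G.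
  unfold rotate, dot at 1; simpl; lra.
Qed.

Definition offset (ar ac a4 s : R) (D : V3) : V3 :=
  mkV3 ((s - ar) * vx D - ac * vy D) (ac * vx D + (s - ar) * vy D) ((s - a4) * vz D).

Lemma offset_shift (ar ac a4 s t : R) (D : V3) :
  offset ar ac a4 t D = vadd (offset ar ac a4 s D) (vscale (t - s) D).
Proof. destruct D; unfold offset, vadd, vscale; simpl; f_equal; ring. Qed.

Lemma image_platform_pt (P : Pose) (n d : V3) (ar t : R) :
  image P (platform_pt n d ar t) = vadd (image P n) (vscale (t - ar) (rotate P d)).
Proof.
  destruct P as [[a1 a2 a3] [b1 b2 b3] [c1 c2 c3] [s1 s2 s3]], n as [n1 n2 n3], d as [d1 d2 d3].
  unfold image, platform_pt, rotate, vadd, vscale, dot; simpl; f_equal; ring.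
Qed.

Lemma sum_sq_pos (x y : R) : y <> 0 -> 0 < x ^ 2 + y ^ 2.
Proof.
  intros Hy; pose proof (pow2_ge_0 x); pose proof (Rsqr_pos_lt y Hy); unfold Rsqr in *; lra.
Qed.

Lemma centre_SM1 (A C ar ac a4 : R) (p2 p3 : Cx) (p4 : R) :
  ac <> 0 -> SM1 A C ar ac a4 p2 p3 p4 ->
  centre A C ar ac a4 = mkV3 (re p2) (- im p2) p4.
Proof.
  intros Hac [-> [_ E4]]; apply (f_equal re) in E4; simpl in E4; subst p4.
  pose proof (sum_sq_pos (a4 - ar) ac Hac) as HQ.
  unfold centre, Ppt, cpar, origin, Cdiv, Cmul, Cinv, Csq, Csub, Cadd, RC, a2C, a3C, vC; simpl.
  destruct (Req_EM_T a4 ar) as [<- | Hne].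
  - f_equal; field; repeat split; intro; nra.
  - assert (a4 - ar <> 0) by lra.
    f_equal; field; repeat split; try lra; intro; nra.
Qed.

Lemma on_ellipsoid_rot_offset (ar ac a4 t : R) (c D : V3) :
  ac <> 0 -> t <> a4 -> dot D D = 1 ->
  on_ellipsoid_rot c (Rabs (a4 - t)) (sqrt ((ar - t) ^ 2 + ac ^ 2))
    (vadd c (offset ar ac a4 t D)).
Proof.
  intros Hac Ht HD; pose proof (sum_sq_pos (ar - t) ac Hac).
  unfold on_ellipsoid_rot; rewrite pow2_sqrt, pow2_abs by lra.
  rewrite <- HD; destruct c as [c1 c2 c3], D as [D1 D2 D3]; unfold offset, vadd, dot; simpl.
  field; split; intro; nra.
Qed.

Lemma offset_at_a4 (ar ac a4 : R) (D : V3) :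
  dot D D = 1 ->
  vz (offset ar ac a4 a4 D) = 0 /\
  vx (offset ar ac a4 a4 D) ^ 2 + vy (offset ar ac a4 a4 D) ^ 2 <= (a4 - ar) ^ 2 + ac ^ 2.
Proof.
  intros HD; destruct D as [D1 D2 D3]; unfold offset, dot in *; simpl in *; split; [ring|].
  pose proof (pow2_ge_0 D3); pose proof (pow2_ge_0 (a4 - ar)); pose proof (pow2_ge_0 ac).
  replace (((a4 - ar) * D1 - ac * D2) ^ 2 + (ac * D1 + (a4 - ar) * D2) ^ 2)
    with (((a4 - ar) ^ 2 + ac ^ 2) * (1 - D3 ^ 2)) by (rewrite <- HD; ring).
  nra.
Qed.

(* The second hypothesis cancels the terms linear in [D], the first the quadratic ones. *)
Lemma dist2_offset (ar ac a4 t p : R) (c Q M D : V3) :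
  dot D D = 1 ->
  dot (offset ar ac a4 t D) Q = dot (offset ar ac a4 0 D) M ->
  dist2 (vadd c (offset ar ac a4 t D)) Q
  = dist2 (vadd c (offset ar ac a4 0 D)) M + 2 * t * dot D (vadd c (offset ar ac a4 p D))
    + dist2 c Q - dist2 c M + t ^ 2 - 2 * t * p.
Proof.
  destruct c as [c1 c2 c3], Q as [q1 q2 q3], M as [m1 m2 m3], D as [D1 D2 D3].
  unfold dist2, offset, vadd, vsub, dot; simpl; intros HD HQM.
  apply Rminus_diag_uniq.
  match goal with |- ?L = 0 => match type of HQM with ?u = ?v => match type of HD with ?w = 1 =>
    transitivity (-2 * (u - v) + (t ^ 2 - 2 * t * p) * (w - 1)); [ring|] end end end.
  rewrite HQM, HD; ring.
Qed.

Lemma offset_dot_Ppt (A C ar ac a4 t : R) (D : V3) :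
  ac <> 0 -> t <> a4 ->
  dot (offset ar ac a4 t D) (Ppt A C ar ac a4 t) = dot (offset ar ac a4 0 D) (mkV3 A 0 C).
Proof.
  intros Hac Ht; pose proof (sum_sq_pos (t - ar) ac Hac).
  destruct D as [D1 D2 D3]; unfold offset, Ppt, dot; simpl.
  field; split; [lra | intro; nra].
Qed.

Lemma ellipsoid_is_sphere_iff (ar ac a4 t : R) :
  ellipsoid_is_sphere (Rabs (a4 - t)) (sqrt ((ar - t) ^ 2 + ac ^ 2))
  <-> (a4 - ar) * (a4 + ar - 2 * t) = ac ^ 2.
Proof.
  unfold ellipsoid_is_sphere.
  assert (Hpos : 0 <= (ar - t) ^ 2 + ac ^ 2)
    by (pose proof (pow2_ge_0 (ar - t)); pose proof (pow2_ge_0 ac); lra).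
  split; intros E.
  - apply (f_equal (fun x => x ^ 2)) in E; rewrite pow2_abs, pow2_sqrt in E by exact Hpos.
    lra.
  - rewrite <- (sqrt_pow2 (Rabs (a4 - t))) by apply Rabs_pos.
    rewrite pow2_abs; f_equal; lra.
Qed.

Definition sphere_radius2 (A C ar ac a4 R1 p5 t : R) : R :=
  let c := centre A C ar ac a4 in
  dist2 c (Ppt A C ar ac a4 t) - dist2 c (mkV3 A 0 C) + R1 ^ 2 + t ^ 2 - 2 * t * p5.

Lemma dist2_ge0 (X Y : V3) : 0 <= dist2 X Y.
Proof.
  destruct X as [x1 x2 x3], Y as [y1 y2 y3]; unfold dist2, vsub, dot; simpl.
  pose proof (pow2_ge_0 (x1 - y1)); pose proof (pow2_ge_0 (x2 - y2));
    pose proof (pow2_ge_0 (x3 - y3)); nra.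
Qed.

Section SelfMotion.

Context {A C ar ac a4 : R} {n d : V3} {R1 p5 p4 : R} {p2 p3 : Cx} {P : Pose}.
Hypothesis Hac : ac <> 0.
Hypothesis Hd : dot d d = 1.
Hypothesis HS : SM1 A C ar ac a4 p2 p3 p4.
Hypothesis HP : self_motion A C ar ac a4 n d R1 p2 p3 p4 p5 P.

Lemma self_motion_rotate_unit : dot (rotate P d) (rotate P d) = 1.
Proof.
  destruct HP as [[H11 [H22 [H33 [H12 [H13 [H23 _]]]]]] _].
  rewrite dot_rotate_orthonormal; auto.
Qed.

Lemma self_motion_foot :
  image P n = vadd (mkV3 (re p2) (- im p2) p4) (offset ar ac a4 ar (rotate P d)).
Proof.
  destruct HP as [_ [_ [<- [_ [<- _]]]]].
  unfold image, offset, platform_pt, platform_ptC, rotate, vadd, vscale, dotRC,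
    Csub, Cadd, Cmul, RC, Ci, a2C; simpl; unfold dot; simpl; f_equal; ring.
Qed.

Lemma self_motion_leg1 : dist2 (image P (platform_pt n d ar 0)) (mkV3 A 0 C) = R1 ^ 2.
Proof. now destruct HP as [_ [H1 _]]. Qed.

Lemma self_motion_leg5 : dot (rotate P d) (image P (platform_pt n d ar p5)) = 0.
Proof.
  destruct HP as [_ [_ [_ [_ [_ H5]]]]].
  rewrite <- H5; unfold image; f_equal.
  destruct (sv P), (rotate P _); unfold vadd; simpl; f_equal; ring.
Qed.

Lemma self_motion_platform_pt (s : R) :
  image P (platform_pt n d ar s) = vadd (centre A C ar ac a4) (offset ar ac a4 s (rotate P d)).
Proof.
  rewrite image_platform_pt, self_motion_foot, (centre_SM1 _ _ _ _ _ _ _ _ Hac HS),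
    (offset_shift ar ac a4 ar s).
  destruct (offset _ _ _ _ _), (vscale _ _); unfold vadd; simpl; f_equal; ring.
Qed.

Lemma self_motion_dist2_Ppt (t : R) :
  t <> a4 ->
  dist2 (image P (platform_pt n d ar t)) (Ppt A C ar ac a4 t)
  = sphere_radius2 A C ar ac a4 R1 p5 t.
Proof.
  intros Ht.
  pose proof self_motion_leg1 as Leg1; pose proof self_motion_leg5 as Leg5.
  rewrite !self_motion_platform_pt in *.
  rewrite (dist2_offset _ _ _ _ p5 _ _ (mkV3 A 0 C)), Leg1, Leg5.
  - unfold sphere_radius2; ring.
  - exact self_motion_rotate_unit.
  - exact (offset_dot_Ppt _ _ _ _ _ _ _ Hac Ht).
Qed.

End SelfMotion.

Theorem mainTheorem2 (A C ar ac a4 : R) (n d : V3) (R1 p5 p4 : R) (p2 p3 : Cx) :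
  A <> 0 -> ac <> 0 ->
  ((a4 <> 0 /\ C <> 0) \/ (a4 = 0 /\ C = 0)) ->
  dot d d = 1 ->
  SM1 A C ar ac a4 p2 p3 p4 ->
  SM2 A C ar ac a4 R1 p5 ->
  let SMo := self_motion A C ar ac a4 n d R1 p2 p3 p4 p5 in
  let Cc := centre A C ar ac a4 in
  (forall t : R, t <> a4 ->
     (forall P : Pose, SMo P ->
        on_ellipsoid_rot Cc (Rabs (a4 - t)) (sqrt ((ar - t) ^ 2 + ac ^ 2))
          (image P (platform_pt n d ar t))) /\
     (exists rho : R, 0 <= rho /\
        forall P : Pose, SMo P ->
          dist2 (image P (platform_pt n d ar t)) (Ppt A C ar ac a4 t) = rho ^ 2)) /\
  (exists rho : R, 0 <= rho /\
     forall P : Pose, SMo P ->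
       let X := image P (platform_pt n d ar a4) in
       vz X = p4 /\ (vx X - vx Cc) ^ 2 + (vy X - vy Cc) ^ 2 <= rho ^ 2) /\
  (a4 <> ar -> forall t : R, t <> a4 ->
     (ellipsoid_is_sphere (Rabs (a4 - t)) (sqrt ((ar - t) ^ 2 + ac ^ 2))
        <-> t = cpar ar ac a4)) /\
  (a4 = ar -> forall t : R, t <> a4 ->
     ~ ellipsoid_is_sphere (Rabs (a4 - t)) (sqrt ((ar - t) ^ 2 + ac ^ 2))).
Proof.
  (* [A <> 0], the type condition and (SM2) only ensure that the self-motion exists. *)
  intros _ Hac _ Hd HS _ SMo Cc.
  split; [|split; [|split]].
  - intros t Ht; split.
    + intros P HP; rewrite (self_motion_platform_pt Hac HS HP).
      exact (on_ellipsoid_rot_offset _ _ _ _ _ _ Hac Ht (self_motion_rotate_unit Hd HP)).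
    + exists (sqrt (sphere_radius2 A C ar ac a4 R1 p5 t)); split; [apply sqrt_pos|].
      intros P HP; rewrite (self_motion_dist2_Ppt Hac Hd HS HP t Ht), pow2_sqrt; [reflexivity|].
      rewrite <- (self_motion_dist2_Ppt Hac Hd HS HP t Ht); apply dist2_ge0.
  - exists (sqrt ((a4 - ar) ^ 2 + ac ^ 2)); split; [apply sqrt_pos|].
    intros P HP X; unfold X, Cc.
    rewrite (self_motion_platform_pt Hac HS HP), (centre_SM1 _ _ _ _ _ _ _ _ Hac HS).
    destruct (offset_at_a4 ar ac a4 _ (self_motion_rotate_unit Hd HP)) as [Hz Hxy].
    rewrite pow2_sqrt by (pose proof (sum_sq_pos (a4 - ar) ac Hac); lra).
    unfold vadd; cbn [vx vy vz]; split; lra.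
  - intros Hne t _; rewrite ellipsoid_is_sphere_iff; unfold cpar.
    split; intros E.
    + field_simplify_eq; lra.
    + subst t; field; lra.
  - intros Heq t _; rewrite ellipsoid_is_sphere_iff, Heq; intros E.
    apply (pow_nonzero ac 2 Hac); lra.
Qed.
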